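(* Let $p, q$ be positive real numbers. Then $$\int_{0}^{1} \left( \frac{x^{p-1}}{\ln x} + \frac{x^{q-1}}{1-x} \right) dx = \ln p - \psi(q).$$
   Context: $\psi$ denotes the digamma function, $\psi(x) = \frac{d}{dx}\log\Gamma(x) = \Gamma'(x)/\Gamma(x)$, where $\Gamma(x)=\int_0^\infty t^{x-1}e^{-t}\,dt$ for $x>0$. *)

(* Defs.v *)
From mathcomp Require Import all_boot all_order all_algebra.
From mathcomp Require Import all_classical all_reals all_analysis.

Set Implicit Arguments.
Unset Strict Implicit.
Unset Printing Implicit Defensive.

Import Order.TTheory GRing.Theory Num.Theory.
Import numFieldNormedType.Exports.

Local Open Scope classical_set_scope.
Local Open Scope ring_scope.

(* Euler's Gamma function; the formula is meaningful for x > 0, where the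
   integral converges. *)
Definition Gamma (R : realType) (x : R) : R :=
  \int[@lebesgue_measure R]_(t in `]0, +oo[) (t `^ (x - 1) * expR (- t)).

Definition digamma (R : realType) (x : R) : R :=
  derive1 (fun y : R => ln (Gamma y)) x.

(* Main.v *)
Require Import Defs.
From mathcomp Require Import all_boot all_order all_algebra.
From mathcomp Require Import all_classical all_reals all_analysis.
From mathcomp Require Import measurable_realfun ring lra.

Set Implicit Arguments.
Unset Strict Implicit.
Unset Printing Implicit Defensive.

Import Order.TTheory GRing.Theory Num.Theory.
Import numFieldNormedType.Exports.

Local Open Scope classical_set_scope.
Local Open Scope ring_scope.

(** Both sides are reduced to the nonnegative kernel
    k_q(x) = x^(q-1) (1/ln x + 1/(1-x)) on the open unit interval, which lies
    between 0 and x^(q-1) because 1/ln x + 1/(1-x) lies between 0 and 1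
    ([ln_inv_bound]).  Write K(q) for its integral, so that 0 <= K(q) <= 1/q.
    The integrand of the theorem is the sum of k_q and of the Frullani integrand
    (x^(p-1) - x^(q-1)) / ln x, and the Frullani integral is ln p - ln q
    ([frullaniE]).  It remains to show that psi(q) = ln q - K(q).

    Put Phi = ln - K.  Since k_q - k_(q+1) is x^(q-1) plus a Frullani integrand,
    Phi(q+1) - Phi(q) = 1/q ([digamma_gap_shift]), and 0 <= ln - Phi <= 1/q.
    On the other side ln Gamma satisfies f(x+1) = f(x) + ln x and Wendel's
    inequality f(x+h) <= f(x) + h ln x for h between 0 and 1.  As in the
    Bohr-Mollerup theorem these four facts are enough
    ([is_derive_of_recurrence]): the remainder r(x) = f(x+h) - f(x) - h Phi(x)
    tends to 0 as x tends to infinity, while r(x+1) - r(x) is of order h^2/x^2,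
    so that summing along x, x+1, x+2, ... gives r(x) = O(h^2) and f' = Phi.
    In particular the Gamma integral is never differentiated under the integral
    sign.

    The facts on Gamma come from its integral taken in the extended reals:
    integration by parts gives the functional equation ([egamma_shift]), and
    Gamma(n+1) = n! with Wendel's inequality ([egamma_wendel]) then yields both
    finiteness and positivity. *)

(** * Elementary inequalities *)

Lemma ln_sub_le (R : realType) (a b : R) : 0 < a -> 0 < b ->
  ln b - ln a <= (b - a) / a.
Proof.
move=> a0 b0; rewrite -ln_div ?posrE//.
have -> : b / a = 1 + (b - a) / a by field; rewrite gt_eqF.
apply: le_ln1Dx; have : 0 < b / a by rewrite divr_gt0.
have -> : b / a = 1 + (b - a) / a by field; rewrite gt_eqF.
by move=> H; rewrite -subr_gt0 opprK addrC.
Qed.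

Lemma ln_sub_ge (R : realType) (a b : R) : 0 < a -> 0 < b ->
  (b - a) / b <= ln b - ln a.
Proof.
move=> a0 b0; have := ln_sub_le b0 a0.
have -> : (a - b) / b = - ((b - a) / b) by ring.
lra.
Qed.

Lemma ln_inv_bound (R : realType) (x : R) : 0 < x < 1 ->
  0 <= (ln x)^-1 + (1 - x)^-1 <= 1.
Proof.
move=> /andP[x0 x1].
have := ln_sub_le ltr01 x0; have := ln_sub_ge ltr01 x0.
rewrite ln1 subr0 divr1 => lnge lnle.
have x1' : 0 < 1 - x by lra.
have L0 : 0 < - ln x by lra.
have -> : (ln x)^-1 = - (- ln x)^-1 by rewrite invrN opprK.
rewrite addrC subr_ge0 lef_pV2 ?posrE//; apply/andP; split; first lra.
rewrite lerBlDr; have -> : 1 + (- ln x)^-1 = (1 - ln x) / - ln x.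
  by field; rewrite lt_eqF//; lra.
rewrite ler_pdivlMr// ler_pdivrMl//.
move: lnge; rewrite ler_pdivrMr//; nra.
Qed.

(** Convexity of the exponent: the graph of b |-> x^b lies above its tangent
    line at a. *)
Lemma powR_tangent (R : realType) (a b x : R) : 0 < x ->
  x `^ a + (b - a) * ln x * x `^ a <= x `^ b.
Proof.
move=> x0; have -> : x `^ b = x `^ a * expR ((b - a) * ln x).
  by rewrite /powR gt_eqF// -expRD; congr expR; ring.
have -> : x `^ a + (b - a) * ln x * x `^ a = x `^ a * (1 + (b - a) * ln x) by ring.
by rewrite ler_wpM2l ?powR_ge0// expR_ge1Dx.
Qed.

(** The same convexity, read on the chord between the exponents 0 and 1. *)
Lemma powR_le_chord (R : realType) (u h : R) : 0 < u -> 0 <= h <= 1 ->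
  u `^ h <= 1 - h + h * u.
Proof.
move=> u0 /andP[h0 h1].
have := powR_tangent h 0 u0; have := powR_tangent h 1 u0.
rewrite powRr0 powRr1 ?(ltW u0)// => t1 t0.
have : (1 - h) * (u `^ h + (0 - h) * ln u * u `^ h) <= (1 - h) * 1.
  by rewrite ler_wpM2l// subr_ge0.
have := ler_wpM2l h0 t1.
lra.
Qed.

(** The map t |-> t^(x+1) e^(-t) has its maximum at t = x + 1, since the tangent
    line of ln there bounds ln t; the right-hand side is this maximum divided by t. *)
Lemma powR_expRN_le (R : realType) (x t : R) : 0 < x -> 0 < t ->
  t `^ x * expR (- t) <= expR ((x + 1) * ln (x + 1) - (x + 1)) / t.
Proof.
move=> x0 t0; have s0 : 0 < x + 1 by rewrite addr_gt0.
rewrite ler_pdivlMr// -[X in _ * X](lnK t0).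
rewrite {1}/powR gt_eqF// -!expRD ler_expR.
have := ln_sub_le s0 t0; rewrite ler_pdivlMr//.
lra.
Qed.

(** * A derivative determined by a functional equation *)

(** A function that grows along x, x+1, x+2, ... is at x at most its limit
    superior along that sequence. *)
Lemma le0_of_shift_nondecreasing (R : realType) (u : R -> R) (c x : R) :
  (forall y, x <= y -> u y <= u (y + 1)) ->
  (forall y, x <= y -> 1 < y -> u y <= c / (y - 1)) -> u x <= 0.
Proof.
move=> u_shift u_le; rewrite leNgt; apply/negP => ux_gt0.
have u_iter n : u x <= u (x + n%:R).
  elim: n => [|n IHn]; first by rewrite addr0.
  apply: (le_trans IHn); rewrite -natr1 addrA; apply: u_shift.
  by rewrite lerDl.
have [n ltn] : exists n : nat, `|x| + 1 + `|c| / u x < n%:R.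
  by exists (Num.truncn (`|x| + 1 + `|c| / u x)).+1; rewrite truncnS_gt.
have cu_ge0 : 0 <= `|c| / u x by rewrite divr_ge0// ltW.
have xn : `|c| / u x < x + n%:R - 1.
  by have := ler_norm (- x); rewrite normrN; lra.
have xn1 : 0 < x + n%:R - 1 by exact: le_lt_trans xn.
have xn_ge : x <= x + n%:R by rewrite lerDl.
have /(le_trans (u_iter n)) : u (x + n%:R) <= c / (x + n%:R - 1).
  by apply: u_le => //; lra.
rewrite ler_pdivlMr// => h.
move: xn; rewrite ltr_pdivrMr// => xn.
by have := ler_norm c; rewrite mulrC in h; lra.
Qed.

Lemma is_derive_quadratic (R : realType) (f : R -> R) (x d C r : R) : 0 < r ->
  (forall h, `|h| <= r -> `|f (x + h) - f x - h * d| <= C * h ^+ 2) ->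
  is_derive x 1 f d.
Proof.
move=> r0 fC.
have C0 : 0 <= C.
  have := fC r; rewrite gtr0_norm// lexx => /(_ isT) /(le_trans (normr_ge0 _)).
  by rewrite pmulr_lge0// exprn_gt0.
have fd : h^-1 *: (f (h *: 1 + x) - f x) @[h --> 0^'] --> d.
  apply/cvgrPdist_le => e e0; near=> h.
  have h0 : h != 0 by near: h; exact: nbhs_dnbhs_neq.
  have hr : `|h| <= r.
    by near: h; apply: dnbhs0_le.
  have he : `|h| <= e / (C + 1).
    by near: h; apply: dnbhs0_le; rewrite divr_gt0// ltr_wpDl.
  have h_gt0 : 0 < `|h| by rewrite normr_gt0.
  have -> : d - h^-1 *: (f (h *: 1 + x) - f x)
            = - (h^-1 * (f (x + h) - f x - h * d)).
    by rewrite /GRing.scale/= mulr1 (addrC h); field.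
  rewrite normrN normrM normfV mulrC ler_pdivrMr//.
  apply: (le_trans (fC _ hr)); rewrite -real_normK ?num_real// expr2 mulrA.
  apply: ler_wpM2r => //.
  move: he; rewrite ler_pdivlMr ?ltr_wpDl// mulrDr mulr1 => he.
  by rewrite mulrC; lra.
apply: DeriveDef; first by apply/cvg_ex; exists d.
exact: cvg_lim fd.
Unshelve. all: by end_near. Qed.

(** The hypotheses on [f] are those that characterize ln Gamma up to an additive
    constant in the Bohr-Mollerup theorem, with convexity replaced by the single
    chord inequality [f_slope]; [Phi] is the candidate derivative, a solution of
    the differentiated recurrence that is asymptotic to ln. *)
Section log_convex_recurrence.
Context {R : realType} (f Phi : R -> R).
Hypothesis f_shift : forall x : R, 0 < x -> f (x + 1) = f x + ln x.
Hypothesis f_slope : forall x h : R, 0 < x -> 0 <= h <= 1 ->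
  f (x + h) <= f x + h * ln x.
Hypothesis Phi_shift : forall x : R, 0 < x -> Phi (x + 1) = Phi x + x^-1.
Hypothesis Phi_ln : forall x : R, 0 < x -> 0 <= ln x - Phi x <= x^-1.

(** The lower bound applies [f_slope] a second time, from x + h up to x + 1. *)
Let increment_ln (x h : R) : 0 < x -> 0 <= h <= 1 ->
  `|f (x + h) - f x - h * ln x| <= h / x.
Proof.
move=> x0 h01; have /andP[h0 h1] := h01.
have xh0 : 0 < x + h by rewrite ltr_pwDl.
have up := f_slope x0 h01.
have : 0 <= 1 - h <= 1 by lra.
move=> /(f_slope xh0).
have -> : x + h + (1 - h) = x + 1 by ring.
rewrite f_shift// => low.
have := ln_sub_le x0 xh0; have -> : x + h - x = h by ring.
move=> lnle.
have hx : 0 <= h / x by rewrite divr_ge0// ltW.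
have : (1 - h) * (ln (x + h) - ln x) <= (1 - h) * (h / x).
  by rewrite ler_wpM2l// subr_ge0.
have : 0 <= h * (h / x) by rewrite mulr_ge0.
rewrite ler_norml; nra.
Qed.

Let remainder x h := f (x + h) - f x - h * Phi x.

(** For negative h, [increment_ln] is used at x + h with the step - h; the bound
    in x - 1 accounts for this base point, which is at least x - 1. *)
Let remainder_large x h : 1 < x -> `|h| <= 1 -> `|remainder x h| <= 3 / (x - 1).
Proof.
move=> x1; rewrite ler_norml => /andP[hN1 h1].
have x0 : 0 < x by lra.
have x10 : 0 < x - 1 by lra.
have /andP[Phi1 Phi2] := Phi_ln x0.
have xx1 : x^-1 <= (x - 1)^-1 by rewrite lef_pV2 ?posrE//; lra.
have x10V : 0 < (x - 1)^-1 by rewrite invr_gt0.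
have [h0|h0] := leP 0 h.
- have := @increment_ln x h x0; rewrite h0 h1 => /(_ isT).
  rewrite /remainder !ler_norml => /andP[l u].
  have : h * x^-1 <= (x - 1)^-1.
    by rewrite -[leRHS]mul1r ler_pM// invr_ge0 ltW.
  have : 0 <= h * (ln x - Phi x) by rewrite mulr_ge0.
  have : h * (ln x - Phi x) <= 1 * (x - 1)^-1.
    by rewrite ler_pM//; exact: le_trans xx1.
  move=> ? ? ?.
  have e : f (x + h) - f x - h * Phi x
    = f (x + h) - f x - h * ln x + h * (ln x - Phi x) by ring.
  rewrite e; apply/andP; split; lra.
- have y0 : 0 < x + h by lra.
  have k01 : 0 <= - h <= 1 by lra.
  have := @increment_ln (x + h) (- h) y0 k01; rewrite addrK.
  rewrite /remainder !ler_norml => /andP[l u].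
  have yx1 : (x + h)^-1 <= (x - 1)^-1 by rewrite lef_pV2 ?posrE//; lra.
  have := ln_sub_le y0 x0; have -> : x - (x + h) = - h by ring.
  move=> lnle.
  have lnge : 0 <= ln x - ln (x + h) by rewrite subr_ge0 ler_ln ?posrE//; lra.
  have b1 : - h * (x + h)^-1 <= (x - 1)^-1.
    by rewrite -[leRHS]mul1r ler_pM ?invr_ge0 ?(ltW y0)//; lra.
  have : 0 <= - h * (ln x - Phi x) by rewrite mulr_ge0//; lra.
  have : - h * (ln x - Phi x) <= 1 * (x - 1)^-1.
    by rewrite ler_pM//; [lra|lra|exact: le_trans xx1].
  have : 0 <= - h * (ln x - ln (x + h)) by rewrite mulr_ge0//; lra.
  have : - h * (ln x - ln (x + h)) <= 1 * (x - 1)^-1.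
    by rewrite ler_pM//; [lra|lra|exact: le_trans b1].
  move=> ? ? ? ?.
  have e : f (x + h) - f x - h * Phi x
    = - (f x - f (x + h) - - h * ln (x + h)) - - h * (ln x - Phi x)
      + - h * (ln x - ln (x + h)) by ring.
  rewrite e; apply/andP; split; lra.
Qed.

(** The recurrences turn the change of the remainder into
    ln (x + h) - ln x - h / x, a second-order Taylor error. *)
Let remainder_shift (x h : R) : 0 < x -> `|h| <= x / 2 ->
  remainder x h - 2 * h ^+ 2 / x ^+ 2 <= remainder (x + 1) h <= remainder x h.
Proof.
move=> x0; rewrite ler_norml => /andP[hl hu].
have xh0 : 0 < x + h by lra.
have -> : remainder (x + 1) h = remainder x h + (ln (x + h) - ln x - h / x).
  rewrite /remainder Phi_shift// f_shift//.
  have -> : x + 1 + h = x + h + 1 by ring.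
  by rewrite f_shift//; ring.
have := ln_sub_le x0 xh0; have := ln_sub_ge x0 xh0.
have -> : x + h - x = h by ring.
move=> l u.
suff : h / x - 2 * h ^+ 2 / x ^+ 2 <= h / (x + h) by lra.
have -> : h / (x + h) = h / x - h ^+ 2 / (x * (x + h)).
  by field; rewrite ?gt_eqF.
rewrite lerD2l lerN2 (mulrC 2) -[leRHS]mulrA ler_wpM2l ?sqr_ge0//.
have -> : 2 / x ^+ 2 = (x * (x / 2))^-1 by field; rewrite gt_eqF.
have x20 : 0 < x / 2 by lra.
rewrite lef_pV2 ?posrE; [|exact: mulr_gt0|exact: mulr_gt0].
by rewrite ler_pM2l//; lra.
Qed.

(** The remainder decreases along x, x+1, ... to 0, hence is nonnegative; after
    subtraction of a telescoping majorant of the sum of the errors it increases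
    to at most 0. *)
Lemma is_derive_of_recurrence (x : R) : 0 < x -> is_derive x 1 f (Phi x).
Proof.
move=> x0.
(* B y - B (y + 1) >= 1 / y^2, so 2 h^2 B dominates the sum over n of the
   errors 2 h^2 / (x + n)^2. *)
pose B (y : R) := (y ^+ 2)^-1 + y^-1.
have B_ge0 y : 0 < y -> 0 <= B y.
  by move=> y0; rewrite addr_ge0// invr_ge0 ?sqr_ge0 ?ltW.
apply: (@is_derive_quadratic _ _ _ _ (2 * B x) (Num.min 1 (x / 2))).
  by rewrite lt_min ltr01 divr_gt0.
move=> h; rewrite le_min => /andP[h1 hx].
have hy y : x <= y -> `|h| <= y / 2 by move=> xy; apply: (le_trans hx); lra.
rewrite -/(remainder x h).
have R_ge0 : 0 <= remainder x h.
  rewrite -oppr_le0.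
  apply: (@le0_of_shift_nondecreasing _ (fun y => - remainder y h) 3) => y xy.
    have /andP[_] := @remainder_shift y h (lt_le_trans x0 xy) (hy _ xy).
    by rewrite lerN2.
  by move=> /remainder_large /(_ h1); rewrite ler_norml => /andP[]; lra.
rewrite ger0_norm// -subr_le0.
apply: (@le0_of_shift_nondecreasing _
          (fun y => remainder y h - 2 * B y * h ^+ 2) 3) => y xy.
  have y0 := lt_le_trans x0 xy.
  have /andP[+ _] := @remainder_shift y h y0 (hy _ xy).
  suff : (y ^+ 2)^-1 + B (y + 1) <= B y.
    move=> /(ler_wpM2r (sqr_ge0 h)).
    have -> : 2 * h ^+ 2 / y ^+ 2 = 2 * ((y ^+ 2)^-1 * h ^+ 2).
      by field; rewrite gt_eqF.
    by lra.
  rewrite /B lerD2l.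
  have -> : y^-1 = (y * (y + 1))^-1 + (y + 1)^-1.
    by field; rewrite !gt_eqF//; lra.
  have y10 : 0 < y + 1 by lra.
  rewrite lerD2r lef_pV2 ?posrE; [|exact: exprn_gt0|exact: mulr_gt0].
  by rewrite expr2 ler_pM2r// lerDl.
move=> y1; have y0 := lt_le_trans x0 xy.
have := remainder_large y1 h1; rewrite ler_norml => /andP[_].
have : 0 <= 2 * B y * h ^+ 2 by rewrite mulr_ge0 ?sqr_ge0// mulr_ge0// B_ge0.
lra.
Qed.

End log_convex_recurrence.

(** * Differentiable functions on segments *)

Lemma derivable_continuous_at (R : realType) (F : R -> R) (x : R) :
  derivable F x 1 -> {for x, continuous F}.
Proof. by move=> /derivable1_diffP /differentiable_continuous. Qed.

Lemma derivable_oo_LRcontinuousW (R : realType) (F : R -> R) (a b : R) :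
  a <= b -> (forall x, a <= x <= b -> derivable F x 1) ->
  derivable_oo_LRcontinuous F a b.
Proof.
move=> ab dF; split.
- by move=> x; rewrite in_itv/= => /andP[/ltW ax /ltW xb]; apply: dF; rewrite ax.
- by apply/cvg_at_right_filter/derivable_continuous_at/dF; rewrite lexx.
- by apply/cvg_at_left_filter/derivable_continuous_at/dF; rewrite lexx andbT.
Qed.

Lemma derivable_within_segment (R : realType) (F : R -> R) (a b : R) :
  (forall x, a <= x <= b -> derivable F x 1) ->
  {within `[a, b], continuous F}.
Proof.
move=> dF; apply: derivable_within_continuous => x; rewrite in_itv/=; exact: dF.
Qed.

Lemma derivable_powR1 (R : realType) (s x : R) : 0 < x ->
  derivable (@powR R ^~ s) x 1.
Proof. by move=> x0; apply: ex_derive; exact: is_derive1_powR. Qed.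

Lemma cvg_invS2 (R : realType) : (n.+2%:R^-1 : R) @[n --> \oo] --> (0 : R).
Proof.
have := @cvg_harmonic R; rewrite -cvg_shiftS; exact.
Qed.

(** * Integrals over the unit interval *)

Section unit_interval_integrals.
Context {R : realType}.
Notation mu := (@lebesgue_measure R).
Implicit Types a b s x p q : R.

Definition frullani_fun a b x : R := (x `^ (b - 1) - x `^ (a - 1)) / ln x.

Definition digamma_kernel s x : R := x `^ (s - 1) * ((ln x)^-1 + (1 - x)^-1).

Definition frullani a b : R := \int[mu]_(x in `]0%R, 1%R[) frullani_fun a b x.

(** This turns out to be ln s - psi(s), see [digammaE]. *)
Definition digamma_gap s : R := \int[mu]_(x in `]0%R, 1%R[) digamma_kernel s x.

(** For s < 1 the integrand is unbounded at 0, hence the exhaustion by segments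
    away from 0. *)
Lemma integral_powR01 s : 0 < s ->
  (\int[mu]_(x in `]0%R, 1%R[) (x `^ (s - 1))%:E = (s^-1)%:E)%E.
Proof.
move=> s0.
have m01 : measurable_fun setT (fun x : R => x `^ (s - 1)).
  by [].
rewrite integral_itv_bndo_bndc; last exact/measurable_EFinP/measurable_funTS.
have itvE : `]0%R, 1%R]%classic = \bigcup_n `[(n.+2%:R)^-1, 1 : R]%classic.
  apply/seteqP; split => [x|x [n _]] /=; rewrite !in_itv/=.
    move=> /andP[x0 x1].
    exists (Num.truncn x^-1) => //=; rewrite in_itv/= x1 andbT.
    rewrite invf_ple ?posrE// (le_trans (ltW (truncnS_gt _)))//.
    by rewrite ler_nat.
  by move=> /andP[nx ->]; rewrite andbT (lt_le_trans _ nx).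
have cvgI : (\int[mu]_(x in `[(n.+2%:R)^-1%R, 1%R]) (x `^ (s - 1))%:E)%E
    @[n --> \oo] --> (\int[mu]_(x in `]0%R, 1%R]) (x `^ (s - 1))%:E)%E.
  rewrite itvE; apply: ge0_nondecreasing_set_cvg_integral => //.
  - move=> n m nm; apply/subsetPset => x/=; rewrite !in_itv/= => /andP[nx ->].
    by rewrite andbT (le_trans _ nx)// lef_pV2 ?posrE// ler_nat.
  - by move=> i; exact/measurable_EFinP/measurable_funTS.
  - by move=> i x _; rewrite lee_fin powR_ge0.
rewrite -(cvg_lim _ cvgI)//.
have FTC n : (\int[mu]_(x in `[(n.+2%:R)^-1%R, 1%R]) (x `^ (s - 1))%:E
             = (s^-1 - s^-1 * ((n.+2%:R)^-1 `^ s))%:E)%E.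
  have n0 : 0 < (n.+2%:R^-1 : R) by [].
  have pos x : n.+2%:R^-1 <= x -> 0 < x by exact: lt_le_trans.
  rewrite (@continuous_FTC2 _ _ (fun x => s^-1 * x `^ s)).
  - by rewrite powR1 mulr1 EFinB.
  - by rewrite invf_lt1// ltr1n.
  - apply: derivable_within_segment => x /andP[nx _].
    by apply: derivable_powR1; exact: pos nx.
  - apply: derivable_oo_LRcontinuousW.
      by rewrite invf_le1// ler1n.
    move=> x /andP[nx _]; apply: derivableM => //.
    by apply: derivable_powR1; exact: pos nx.
  - move=> x; rewrite in_itv/= => /andP[/ltW/pos x0 _].
    rewrite derive1Ml; last exact: derivable_powR1.
    rewrite powR_derive1 ?in_itv/= ?x0//.
    by rewrite mulrA mulVf ?mul1r ?gt_eqF.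
under eq_fun do rewrite FTC.
apply/cvg_lim => //.
apply: cvg_EFin; first exact: nearW.
rewrite -[in X in _ --> X](subr0 s^-1); apply: cvgB; first exact: cvg_cst.
rewrite -[X in _ --> X](mulr0 s^-1); apply: cvgM; first exact: cvg_cst.
have /cvg_at_rightP := @powR_cvg0 R s s0; apply; split => //.
exact: cvg_invS2.
Qed.

Lemma integrable_powR01 s : 0 < s ->
  mu.-integrable `]0%R, 1%R[ (EFin \o (fun x : R => x `^ (s - 1))).
Proof.
move=> s0; apply/integrableP; split.
  exact/measurable_EFinP/measurable_funTS.
rewrite (_ : (\int[mu]_(x in _) _)%E = (s^-1)%:E) ?ltry//.
rewrite -integral_powR01//; apply: eq_integral => x _ /=.
by rewrite ger0_norm// powR_ge0.
Qed.

Lemma Rintegral_powR01 s : 0 < s ->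
  \int[mu]_(x in `]0%R, 1%R[) (x `^ (s - 1)) = s^-1.
Proof. by move=> s0; rewrite /Rintegral integral_powR01. Qed.

Lemma dominated_integrable01 (f g : R -> R) :
  (forall x, 0 < x < 1 -> derivable f x 1) ->
  (forall x, 0 < x < 1 -> `|f x| <= g x) ->
  mu.-integrable `]0%R, 1%R[ (EFin \o g) ->
  mu.-integrable `]0%R, 1%R[ (EFin \o f).
Proof.
move=> df fg; apply: le_integrable => //.
  apply/measurable_EFinP; apply: open_continuous_measurable_fun.
    exact: interval_open.
  move=> x; rewrite inE/= in_itv/= => x01.
  exact/derivable_continuous_at/df.
move=> x; rewrite /= in_itv/= => /fg fgx.
by rewrite lee_fin (le_trans fgx)// ler_norm.
Qed.

Lemma derivable_ln_inv x : 0 < x < 1 -> derivable (fun y : R => (ln y)^-1) x 1.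
Proof.
move=> x01; have /andP[x0 _] := x01; apply: derivableV.
  by rewrite lt_eqF// ln_lt0.
by apply: ex_derive; exact: is_derive1_ln.
Qed.

(** [powR_tangent] divided by ln x, which is negative. *)
Lemma frullani_fun_ub a b x : 0 < x < 1 ->
  frullani_fun a b x <= (b - a) * x `^ (a - 1).
Proof.
move=> x01; have /andP[x0 _] := x01; have lnx := ln_lt0 x01.
rewrite /frullani_fun ler_ndivrMr//.
have := powR_tangent (a - 1) (b - 1) x0.
have -> : b - 1 - (a - 1) = b - a by ring.
lra.
Qed.

Lemma frullani_fun_lb a b x : 0 < x < 1 ->
  (b - a) * x `^ (b - 1) <= frullani_fun a b x.
Proof.
move=> /(frullani_fun_ub b a).
by rewrite /frullani_fun -opprB mulNr -[a - b]opprB mulNr lerN2.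
Qed.

Lemma integrable_frullani_fun a b : 0 < a -> 0 < b ->
  mu.-integrable `]0%R, 1%R[ (EFin \o frullani_fun a b).
Proof.
move=> a0 b0.
apply: (@dominated_integrable01 _
  (fun x => `|b - a| * x `^ (a - 1) + `|b - a| * x `^ (b - 1))).
- move=> x x01; have /andP[x0 _] := x01.
  apply: derivableM; last exact: derivable_ln_inv.
  by apply: derivableB; exact: derivable_powR1.
- move=> x x01; have ub := frullani_fun_ub a b x01.
  have lb := frullani_fun_lb a b x01.
  have pa : 0 <= x `^ (a - 1) by exact: powR_ge0.
  have pb : 0 <= x `^ (b - 1) by exact: powR_ge0.
  have := ler_wpM2r pa (ler_norm (b - a)).
  have := ler_wpM2r pb (ler_norm (- (b - a))).
  have := ler_wpM2r pa (normr_ge0 (b - a)).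
  have := ler_wpM2r pb (normr_ge0 (b - a)).
  by rewrite normrN mulNr !mul0r ler_norml; lra.
- have m01 : measurable (`]0%R, 1%R[ : set (measurableTypeR R)) by [].
  exact: (integrableD m01 (integrableZl m01 `|b - a| (integrable_powR01 a0))
                          (integrableZl m01 `|b - a| (integrable_powR01 b0))).
Qed.

Lemma integrable_digamma_kernel s : 0 < s ->
  mu.-integrable `]0%R, 1%R[ (EFin \o digamma_kernel s).
Proof.
move=> s0; apply: dominated_integrable01 (integrable_powR01 s0).
- move=> x x01; have /andP[x0 x1] := x01.
  apply: derivableM; first exact: derivable_powR1.
  apply: derivableD; first exact: derivable_ln_inv.
  apply: derivableV; first by rewrite gt_eqF// subr_gt0.
  exact: derivableB.
- move=> x x01; have /andP[k0 k1] := ln_inv_bound x01.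
  by rewrite /digamma_kernel ger0_norm ?mulr_ge0 ?powR_ge0// ler_piMr ?powR_ge0.
Qed.

Lemma digamma_gap_bound s : 0 < s -> 0 <= digamma_gap s <= s^-1.
Proof.
move=> s0; apply/andP; split.
  apply: Rintegral_ge0 => x; rewrite /= in_itv/= => /ln_inv_bound/andP[k0 _].
  by rewrite mulr_ge0 ?powR_ge0.
rewrite -Rintegral_powR01//; apply: le_Rintegral => //.
- exact: integrable_digamma_kernel.
- exact: integrable_powR01.
- move=> x; rewrite /= in_itv/= => /ln_inv_bound/andP[_ k1].
  by rewrite ler_piMr ?powR_ge0.
Qed.

Lemma frullani_chasles a b c : 0 < a -> 0 < b -> 0 < c ->
  frullani a c = frullani a b + frullani b c.
Proof.
move=> a0 b0 c0; rewrite -RintegralD//; try exact: integrable_frullani_fun.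
by apply: eq_Rintegral => x _; rewrite /frullani_fun; ring.
Qed.

(** Both the Frullani integral and ln b - ln a lie between (b - a) / b and
    (b - a) / a. *)
Lemma frullani_near_ln a b : 0 < a -> 0 < b ->
  `|frullani a b - (ln b - ln a)| <= (b - a) ^+ 2 / (a * b).
Proof.
move=> a0 b0.
have int_powR c d : 0 < c ->
    \int[mu]_(x in `]0%R, 1%R[) (d * x `^ (c - 1)) = d / c.
  move=> c0; rewrite RintegralZl ?Rintegral_powR01//.
  exact: integrable_powR01.
have intg c d : 0 < c ->
    mu.-integrable `]0%R, 1%R[ (EFin \o (fun x : R => d * x `^ (c - 1))).
  move=> c0; have m01 : measurable (`]0%R, 1%R[ : set (measurableTypeR R)) by [].
  exact: (integrableZl m01 d (integrable_powR01 c0)).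
have ub : frullani a b <= (b - a) / a.
  rewrite -int_powR//; apply: le_Rintegral => //; [|exact: intg|].
    exact: integrable_frullani_fun.
  by move=> x; rewrite /= in_itv/=; exact: frullani_fun_ub.
have lb : (b - a) / b <= frullani a b.
  rewrite -int_powR//; apply: le_Rintegral => //; [exact: intg| |].
    exact: integrable_frullani_fun.
  by move=> x; rewrite /= in_itv/=; exact: frullani_fun_lb.
have -> : (b - a) ^+ 2 / (a * b) = (b - a) / a - (b - a) / b.
  by field; rewrite !gt_eqF.
by have := ln_sub_le a0 b0; have := ln_sub_ge a0 b0; rewrite ler_norml; lra.
Qed.

(** The difference of the two sides is additive in the interval between a and b
    and of second order in its length, so it vanishes: cutting into n + 1 equal
    pieces leaves an error of order 1 / (n + 1). *)
Lemma frullaniE a b : 0 < a -> 0 < b -> frullani a b = ln b - ln a.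
Proof.
move=> a0 b0.
(* m bounds the division points t n k away from 0, whichever of a and b is
   the smaller. *)
pose m := Num.min a b.
have m0 : 0 < m by rewrite lt_min a0.
pose t (n k : nat) := a + (b - a) * (k%:R / n.+1%:R).
have t_gt0 n k : (k <= n.+1)%N -> 0 < t n k /\ m <= t n k.
  move=> kn; suff mt : m <= t n k by split=> //; exact: lt_le_trans mt.
  have r0 : (0:R) <= k%:R / n.+1%:R by rewrite divr_ge0.
  have r1 : k%:R / n.+1%:R <= (1:R) by rewrite ler_pdivrMr// mul1r ler_nat.
  have ma : m <= a by rewrite ge_min lexx.
  have mb : m <= b by rewrite ge_min lexx orbT.
  rewrite /t; set r := _ / _ in r0 r1 *.
  have : (1 - r) * m <= (1 - r) * a by rewrite ler_wpM2l// subr_ge0.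
  have : r * m <= r * b by rewrite ler_wpM2l.
  lra.
pose D c := frullani a c - (ln c - ln a).
have D_le n k : (k <= n.+1)%N ->
    `|D (t n k)| <= k%:R * ((b - a) ^+ 2 / m ^+ 2 / n.+1%:R ^+ 2).
  elim: k => [_|k IHk kn].
    have ta : t n 0 = a by rewrite /t mul0r mulr0 addr0.
    have := frullani_near_ln a0 a0.
    by rewrite /D ta !subrr expr0n/= !mul0r.
  have [tk mk] := t_gt0 n k (ltnW kn).
  have [tk1 mk1] := t_gt0 n k.+1 kn.
  have -> : D (t n k.+1) = D (t n k) +
      (frullani (t n k) (t n k.+1) - (ln (t n k.+1) - ln (t n k))).
    by rewrite /D (frullani_chasles a0 tk tk1); ring.
  apply: (le_trans (ler_normD _ _)).
  rewrite -natr1 mulrDl mul1r; apply: lerD; first exact/IHk/ltnW.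
  apply: (le_trans (frullani_near_ln tk tk1)).
  have -> : t n k.+1 - t n k = (b - a) / n.+1%:R.
    by rewrite /t -natr1; field; rewrite gt_eqF.
  rewrite expr_div_n mulrAC ler_pM2r ?invr_gt0 ?exprn_gt0//.
  rewrite ler_wpM2l ?sqr_ge0// lef_pV2 ?posrE ?mulr_gt0 ?exprn_gt0//.
  by rewrite expr2 ler_pM// ltW.
have D0 : `|D b| <= 0.
  apply/ler_addgt0Pl => e e0; rewrite addr0.
  pose C := (b - a) ^+ 2 / m ^+ 2.
  have [n ltn] : exists n : nat, C / e < n.+1%:R.
    by exists (Num.truncn (C / e)); rewrite truncnS_gt.
  have := D_le n n.+1 (leqnn _).
  have -> : t n n.+1 = b by rewrite /t divff ?pnatr_eq0// mulr1 addrC subrK.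
  move=> /le_trans; apply.
  have -> : n.+1%:R * (C / n.+1%:R ^+ 2) = C / n.+1%:R.
    by field; rewrite gt_eqF.
  by rewrite ler_pdivrMr// mulrC -ler_pdivrMr// ltW.
move: D0; rewrite normr_le0 => /eqP; rewrite /D; lra.
Qed.

(** Multiplying the kernel by 1 - x cancels 1 / (1 - x): the difference of two
    consecutive kernels is a Frullani integrand plus x^(q-1). *)
Lemma digamma_gap_shift q : 0 < q ->
  digamma_gap q - digamma_gap (q + 1) = ln q - ln (q + 1) + q^-1.
Proof.
move=> q0; have q10 : 0 < q + 1 by rewrite addr_gt0.
rewrite -(frullaniE q10 q0) -(Rintegral_powR01 q0).
rewrite -RintegralD//; [|exact: integrable_frullani_fun|exact: integrable_powR01].
rewrite -RintegralB//; try exact: integrable_digamma_kernel.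
apply: eq_Rintegral => x; rewrite inE/= in_itv/= => x01.
have /andP[x0 x1] := x01.
rewrite /digamma_kernel /frullani_fun.
have -> : x `^ (q + 1 - 1) = x `^ (q - 1) * x.
  have -> : q + 1 - 1 = q - 1 + 1 by ring.
  by rewrite powRD ?(gt_eqF x0) ?implybT// powRr1 ?ltW.
have lnx_neq0 : ln x != 0 by rewrite lt_eqF// ln_lt0.
have x1_neq0 : 1 - x != 0 by rewrite gt_eqF// subr_gt0.
by field; rewrite x1_neq0 lnx_neq0.
Qed.

(** The Frullani part trades the exponent p for q, which makes the poles of
    1 / ln x and 1 / (1 - x) at 1 cancel. *)
Lemma integral_frullani_kernel p q : 0 < p -> 0 < q ->
  (\int[mu]_(x in `]0%R, 1%R[)
     (x `^ (p - 1) / ln x + x `^ (q - 1) / (1 - x))%:E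
   = (ln p - (ln q - digamma_gap q))%:E)%E.
Proof.
move=> p0 q0.
have -> : ln p - (ln q - digamma_gap q) = frullani q p + digamma_gap q.
  by rewrite frullaniE//; ring.
have fi := integrable_frullani_fun q0 p0.
have ki := integrable_digamma_kernel q0.
rewrite -RintegralD// /Rintegral fineK; last first.
  have m01 : measurable (`]0%R, 1%R[ : set (measurableTypeR R)) by [].
  exact: (integrable_fin_num m01 (integrableD m01 fi ki)).
apply: eq_integral => x; rewrite inE/= in_itv/= => x01.
by congr EFin; rewrite /frullani_fun /digamma_kernel; ring.
Qed.

End unit_interval_integrals.

(** * The Gamma function *)

Lemma derive1_NexpRN (R : realType) (t : R) :
  derive1 (fun t : R => - expR (- t)) t = expR (- t).
Proof. by rewrite derive1E derive_val /GRing.scale/= mulrN1 opprK.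
Qed.

Section gamma_function.
Context {R : realType}.
Notation mu := (@lebesgue_measure R).
Implicit Types x y h t : R.

Definition gamma_fun x t : R := t `^ (x - 1) * expR (- t).

(** The Gamma integral in the extended reals, where the functional equation and
    Wendel's inequality hold before finiteness is known. *)
Definition egamma x : \bar R :=
  (\int[mu]_(t in `]0%R, +oo[) (gamma_fun x t)%:E)%E.

Lemma gamma_fun_ge0 x t : 0 <= gamma_fun x t.
Proof. by rewrite mulr_ge0 ?powR_ge0 ?expR_ge0. Qed.

Lemma measurable_gamma_fun x (D : set R) : measurable_fun D (gamma_fun x).
Proof.
apply: measurable_funTS; apply: measurable_funM => //.
exact: measurableT_comp.
Qed.

Lemma gamma_fun_shift x t : 0 < t -> gamma_fun (x + 1) t = t `^ x * expR (- t).
Proof. by move=> t0; rewrite /gamma_fun addrK. Qed.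

(** The segments start at n + 2 so that they are never reduced to a point, as
    integration by parts requires. *)
Lemma cvg_egamma x :
  (\int[mu]_(t in `[n.+2%:R^-1%R, n.+2%:R%R]) (gamma_fun x t)%:E)%E
    @[n --> \oo] --> egamma x.
Proof.
rewrite /egamma.
have -> : `]0%R, +oo[%classic = \bigcup_n `[(n.+2%:R)^-1, n.+2%:R : R]%classic.
  apply/seteqP; split => [t|t [n _]] /=; rewrite !in_itv/= ?andbT.
    move=> t0; exists (Num.truncn t^-1 + Num.truncn t)%N => //=.
    rewrite in_itv/= invf_ple ?posrE//; apply/andP; split.
      by rewrite (le_trans (ltW (truncnS_gt _)))// ler_nat ltnS leqW// leq_addr.
    by rewrite (le_trans (ltW (truncnS_gt _)))// ler_nat ltnS leqW// leq_addl.
  by move=> /andP[nt _]; rewrite (lt_le_trans _ nt).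
apply: ge0_nondecreasing_set_cvg_integral => //.
- move=> n m nm; apply/subsetPset => t/=; rewrite !in_itv/= => /andP[nt tn].
  by rewrite (le_trans _ nt) ?(le_trans tn) ?ler_nat// lef_pV2 ?posrE// ler_nat.
- by move=> i; apply/measurable_EFinP; exact: measurable_gamma_fun.
- by move=> i t _; rewrite lee_fin gamma_fun_ge0.
Qed.

Lemma gamma_by_parts_segment x a b : 0 < x -> 0 < a -> a < b ->
  (\int[mu]_(t in `[a, b]) (gamma_fun (x + 1) t)%:E =
   (a `^ x * expR (- a) - b `^ x * expR (- b))%:E
   + x%:E * \int[mu]_(t in `[a, b]) (gamma_fun x t)%:E)%E.
Proof.
move=> x0 a0 ab.
have pos t : a <= t <= b -> 0 < t by move=> /andP[at_ _]; exact: lt_le_trans at_.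
have dE (t : R) : derivable (fun t : R => expR (- t)) t 1 by [].
have dE' (t : R) : derivable (fun t : R => - expR (- t)) t 1 by [].
have dP s t : a <= t <= b -> derivable (@powR R ^~ s) t 1.
  by move=> /pos; exact: derivable_powR1.
have := @integration_by_parts _ (@powR R ^~ x) (fun t => - expR (- t))
  (fun t => x * t `^ (x - 1)) (fun t => expR (- t)) _ _ ab.
rewrite /gamma_fun addrK => ->; last 6 first.
- apply: derivable_within_segment => t tab; apply: derivableM => //.
  exact: dP.
- by apply: derivable_oo_LRcontinuousW; [exact: ltW|move=> t; exact: dP].
- move=> t; rewrite in_itv/= => /andP[/(lt_trans a0) t0 _].
  by rewrite powR_derive1// in_itv/= t0.
- exact: derivable_within_segment.
- by apply: derivable_oo_LRcontinuousW; [exact: ltW|].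
- by move=> t _; rewrite derive1_NexpRN.
have dg t : a <= t <= b -> derivable (gamma_fun x) t 1.
  by move=> tab; apply: derivableM => //; exact: dP.
have intg : mu.-integrable `[a, b] (EFin \o gamma_fun x).
  apply: continuous_compact_integrable; first exact: segment_compact.
  exact: derivable_within_segment.
have -> : (\int[mu]_(t in `[a, b]) (x * t `^ (x - 1) * - expR (- t))%:E
    = (- x)%:E * \int[mu]_(t in `[a, b]) (gamma_fun x t)%:E)%E.
  rewrite -integralZl//; apply: eq_integral => t _.
  by rewrite -EFinM; congr EFin; rewrite /gamma_fun; ring.
rewrite EFinN mulNe oppeK; congr (_%:E + _)%E.
ring.
Qed.

(** Integration by parts on the segments [1/(n+2), n+2], whose boundary terms
    vanish in the limit; the equation holds even if both sides are infinite. *)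
Lemma egamma_shift x : 0 < x -> egamma (x + 1) = (x%:E * egamma x)%E.
Proof.
move=> x0.
have b0 : (n.+2%:R `^ x * expR (- n.+2%:R) : R) @[n --> \oo] --> (0 : R).
  pose C := expR ((x + 1) * ln (x + 1) - (x + 1)).
  apply: (@squeeze_cvgr _ _ _ _ (fun=> 0) (fun n => C * n.+2%:R^-1)).
  - apply: nearW => n; rewrite mulr_ge0 ?powR_ge0 ?expR_ge0//=.
    exact: powR_expRN_le.
  - exact: cvg_cst.
  - rewrite -[X in _ --> X](mulr0 C); apply: cvgM; first exact: cvg_cst.
    exact: cvg_invS2.
have a0 : (n.+2%:R^-1 `^ x * expR (- n.+2%:R^-1) : R) @[n --> \oo] --> (0 : R).
  apply: (@squeeze_cvgr _ _ _ _ (fun=> 0) (fun n => n.+2%:R^-1 `^ x)).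
  - apply: nearW => n; rewrite mulr_ge0 ?powR_ge0 ?expR_ge0//=.
    by rewrite ler_piMr ?powR_ge0// expR_le1 oppr_le0.
  - exact: cvg_cst.
  - have /cvg_at_rightP := @powR_cvg0 R x x0; apply; split => //.
    exact: cvg_invS2.
rewrite -(cvg_lim _ (@cvg_egamma (x + 1)))//.
apply/cvg_lim => //.
rewrite (_ : (fun n => _) = (fun n : nat =>
    (n.+2%:R^-1 `^ x * expR (- n.+2%:R^-1) - n.+2%:R `^ x * expR (- n.+2%:R))%:E
    + x%:E * \int[mu]_(t in `[n.+2%:R^-1%R, n.+2%:R%R]) (gamma_fun x t)%:E)%E);
  last first.
  apply/funext => n; apply: gamma_by_parts_segment => //.
  by rewrite (@lt_trans _ _ 1) ?invf_lt1 ?ltr1n.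
rewrite -[X in _ --> X]add0e; apply: cvgeD.
- exact: fin_num_adde_defr.
- apply: cvg_EFin; first exact: nearW.
  by rewrite -(subr0 0); exact: cvgB.
- by apply: cvgeZl => //; exact: cvg_egamma.
Qed.

Lemma egamma1 : egamma 1 = 1%E.
Proof.
rewrite /egamma /gamma_fun subrr.
under eq_integral do rewrite powRr0 mul1r.
rewrite integral_itv_obnd_cbnd; last first.
  exact/measurable_EFinP/measurable_funTS/measurableT_comp.
have dE (t : R) : derivable (fun t : R => expR (- t)) t 1 by [].
have dE' (t : R) : derivable (fun t : R => - expR (- t)) t 1 by [].
rewrite (@ge0_continuous_FTC2y _ _ (fun t => - expR (- t)) _ 0).
- by rewrite oppr0 expR0 -EFinB opprK add0r.
- by move=> t _; exact: expR_ge0.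
- apply: derivable_within_continuous => t _; exact: dE.
- by rewrite -oppr0; apply: cvgN; exact: cvgr_expR.
- by move=> t _; exact: dE'.
- by apply: cvg_at_right_filter; exact: (derivable_continuous_at (dE' 0)).
- by move=> t _; rewrite derive1_NexpRN.
Qed.

Lemma egamma_nat n : egamma n.+1%:R = (n`!%:R)%:E.
Proof.
elim: n => [|n IHn]; first by rewrite egamma1 fact0.
by rewrite -natr1 egamma_shift// IHn -EFinM -natrM factS.
Qed.

Lemma egamma_ge0 x : (0 <= egamma x)%E.
Proof. by apply: integral_ge0 => t _; rewrite lee_fin gamma_fun_ge0. Qed.

(** Wendel's inequality: with t = x u, the integrand carries the factor u^h,
    which lies below the chord 1 - h + h u ([powR_le_chord]); the chord
    integrates to x^h Gamma(x) by the functional equation. *)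
Lemma egamma_wendel x h : 0 < x -> 0 <= h <= 1 ->
  (egamma (x + h) <= (x `^ h)%:E * egamma x)%E.
Proof.
move=> x0 h01; have /andP[h0 h1] := h01.
have xh0 : 0 <= x `^ h by exact: powR_ge0.
have c0 : 0 <= x `^ h * (1 - h) by rewrite mulr_ge0// subr_ge0.
have c1 : 0 <= x `^ h * h / x by rewrite divr_ge0 ?mulr_ge0// ltW.
have mg (c y : R) : measurable_fun (`]0%R, +oo[ : set R)
    (fun t : R => c * gamma_fun y t).
  by apply: measurable_funM => //; exact: measurable_gamma_fun.
apply: (@le_trans _ _ (\int[mu]_(t in `]0%R, +oo[)
    ((x `^ h * (1 - h) * gamma_fun x t)%:E
     + (x `^ h * h / x * gamma_fun (x + 1) t)%:E))%E).
  apply: ge0_le_integral => //.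
  - by move=> t _; rewrite lee_fin gamma_fun_ge0.
  - apply/measurable_EFinP; exact: measurable_gamma_fun.
  - by apply: emeasurable_funD; apply/measurable_EFinP; exact: mg.
  - move=> t; rewrite /= in_itv/= andbT => t0; rewrite -EFinD lee_fin.
    have tx0 : 0 < t / x by rewrite divr_gt0.
    have := powR_le_chord tx0 h01.
    rewrite gamma_fun_shift// /gamma_fun.
    have -> : t `^ (x + h - 1) = x `^ h * (t / x) `^ h * t `^ (x - 1).
      rewrite -powRM ?(ltW x0) ?(ltW tx0)//.
      have -> : x * (t / x) = t by field; rewrite gt_eqF.
      rewrite -powRD ?(gt_eqF t0) ?implybT//; congr (_ `^ _); ring.
    have -> : t `^ x = t * t `^ (x - 1) by rewrite mulr_powRB1// ltW.
    move=> /(ler_wpM2l xh0) /(ler_wpM2r (gamma_fun_ge0 x t)).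
    rewrite /gamma_fun => /le_trans le; rewrite -mulrA; apply: le.
    rewrite le_eqVlt; apply/orP; left; apply/eqP; field.
    by rewrite gt_eqF.
rewrite ge0_integralD//; last 4 first.
- by move=> t _; rewrite lee_fin mulr_ge0// gamma_fun_ge0.
- by apply/measurable_EFinP; exact: mg.
- by move=> t _; rewrite lee_fin mulr_ge0// gamma_fun_ge0.
- by apply/measurable_EFinP; exact: mg.
under eq_integral do rewrite EFinM.
under [X in (_ + X)%E]eq_integral do rewrite EFinM.
rewrite !ge0_integralZl//; last 4 first.
- apply/measurable_EFinP; exact: measurable_gamma_fun.
- by move=> t _; rewrite lee_fin gamma_fun_ge0.
- apply/measurable_EFinP; exact: measurable_gamma_fun.
- by move=> t _; rewrite lee_fin gamma_fun_ge0.
rewrite -/(egamma x) -/(egamma (x + 1)) egamma_shift// muleA -EFinM.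
rewrite -ge0_muleDl ?lee_fin//; last by rewrite mulr_ge0// ltW.
rewrite -EFinD; have -> : x `^ h * (1 - h) + x `^ h * h / x * x = x `^ h.
  by field; rewrite gt_eqF.
by [].
Qed.

(** With n <= x < n + 1, Wendel's inequality from n + 1 up to x + 1 bounds
    Gamma(x + 1) above by a multiple of n!, and from x up to n + 1 bounds a
    multiple of Gamma(x) below by n!. *)
Lemma egammaE x : 0 < x -> egamma x = (Gamma x)%:E /\ 0 < Gamma x.
Proof.
move=> x0.
pose n := Num.truncn x.
have /andP[nx xn] : n%:R <= x < n.+1%:R by exact: truncn_itv (ltW x0).
have fin : egamma x \is a fin_num.
  rewrite ge0_fin_numE ?egamma_ge0//.
  have : (egamma (x + 1) < +oo)%E.
    have -> : x + 1 = n.+1%:R + (x - n%:R) by rewrite -natr1; ring.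
    apply: (@le_lt_trans _ _ ((n.+1%:R `^ (x - n%:R))%:E * egamma n.+1%:R)%E).
      by apply: egamma_wendel => //; rewrite -natr1 in xn; lra.
    by rewrite egamma_nat -EFinM ltry.
  rewrite egamma_shift//; have := egamma_ge0 x.
  case: (egamma x) => [r _ _|_|//]; first exact: ltry.
  by rewrite gt0_muley ?lte_fin.
have e : egamma x = (Gamma x)%:E by rewrite /Gamma /Rintegral fineK.
split=> //.
have h01 : 0 <= n.+1%:R - x <= 1 by rewrite -natr1 in xn *; lra.
have := egamma_wendel x0 h01; rewrite addrC subrK egamma_nat e -EFinM lee_fin.
have : (0 : R) < (Num.truncn x)`!%:R by rewrite ltr0n fact_gt0.
move=> /lt_le_trans /[apply].
by rewrite pmulr_rgt0// powR_gt0.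
Qed.

Lemma Gamma_gt0 x : 0 < x -> 0 < Gamma x.
Proof. by move=> /egammaE[]. Qed.

Lemma Gamma_shift x : 0 < x -> Gamma (x + 1) = x * Gamma x.
Proof.
move=> x0; have x10 : 0 < x + 1 by rewrite addr_gt0.
apply: EFin_inj; rewrite EFinM.
by rewrite -(egammaE x0).1 -(egammaE x10).1 egamma_shift.
Qed.

Lemma Gamma_wendel x h : 0 < x -> 0 <= h <= 1 ->
  Gamma (x + h) <= x `^ h * Gamma x.
Proof.
move=> x0 h01; have /andP[h0 _] := h01.
have xh0 : 0 < x + h by rewrite ltr_pwDl.
rewrite -lee_fin EFinM -(egammaE x0).1 -(egammaE xh0).1.
exact: egamma_wendel.
Qed.

Lemma digammaE (q : R) : 0 < q -> digamma q = ln q - digamma_gap q.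
Proof.
move=> q0; rewrite /digamma derive1E.
suff : is_derive q 1 (fun y : R => ln (Gamma y)) (ln q - digamma_gap q).
  by move=> ?; apply: derive_val.
apply: (@is_derive_of_recurrence _ (fun y => ln (Gamma y))
          (fun y => ln y - digamma_gap y)) => // [x x0|x h x0 h01|x x0|x x0].
- by rewrite Gamma_shift// lnM ?posrE ?Gamma_gt0// addrC.
- have /andP[h0 _] := h01; have xh0 : 0 < x + h by rewrite ltr_pwDl.
  rewrite -(ln_powR x h) [leRHS]addrC -lnM ?posrE ?Gamma_gt0 ?powR_gt0//.
  by rewrite ler_ln ?posrE ?mulr_gt0 ?Gamma_gt0 ?powR_gt0// Gamma_wendel.
- by have := digamma_gap_shift x0; lra.
- by have := digamma_gap_bound x0; lra.
Qed.

End gamma_function.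

(* The integral is the extended-real Lebesgue integral, so its being equal to a
   real number includes the integrability of the (measurable) integrand. *)
Theorem proposition2p16 (R : realType) (p q : R) (hp : 0 < p) (hq : 0 < q) :
  (\int[@lebesgue_measure R]_(x in `]0%R, 1%R[)
     (x `^ (p - 1) / ln x + x `^ (q - 1) / (1 - x))%:E
   = (ln p - digamma q)%:E)%E.
Proof. by rewrite digammaE// integral_frullani_kernel. Qed.
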